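(* The following hold. (a) Let $\tau$ be an infinite cardinal, let $Y$ be a Banach space with $w(Y)\leq\tau$, and let $0\leq\alpha<1$. Whenever $X$ is a $\tau$-PF-normal space, every l.s.c. mapping $\varphi:X\to\mathscr{C}_{\alpha}(Y)$ has a continuous selection, i.e. there is a continuous $f:X\to Y$ with $f(x)\in\varphi(x)$ for every $x\in X$. (b) For every $0\leq\alpha<1$ there exists $\delta=\delta(\alpha)>0$, depending only on $\alpha$, such that: if $\tau$ is an infinite cardinal, $Y$ is a Banach space with $w(Y)\leq\tau$, $X$ is a $\tau$-PF-normal space, $\varphi:X\to\mathscr{C}_{\alpha}(Y)$ is l.s.c., and $g:X\to Y$ is a continuous $r$-selection for $\varphi$ for some $r>0$, then $\varphi$ has a continuous selection $f:X\to Y$ with $d(g(x),f(x))<\delta r$ for all $x\in X$.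
   Context: Notation: $w(Y)$ is the topological weight of $Y$. For a normed space $Y$, $d$ is the metric on $Y$ generated by the norm; $d(p,P)=\inf_{q\in P}d(p,q)$ and $B_r(x)=\{y\in Y: d(x,y)<r\}$. $2^Y$ is the family of all non-empty subsets of $Y$; $\mathscr{C}(Y)$ is the family of all non-empty compact (closed) subsets of $Y$. $\operatorname{conv}(A)$ is the convex hull of $A$. Paraconvexity: for $0\leq\alpha\leq 1$, a subset $P$ of a normed space $Y$ is $\alpha$-paraconvex if whenever $r>0$ and $d(p,P)<r$ for some $p\in Y$, then $d(q,P)\leq\alpha r$ for all $q\in\operatorname{conv}(B_r(p)\cap P)$. $\mathscr{C}_{\alpha}(Y)$ is the set of all $\alpha$-paraconvex members of $\mathscr{C}(Y)$. Set-valued mappings: $\varphi:X\to 2^Y$ is lower semi-continuous (l.s.c.) if $\varphi^{-1}(U)=\{x\in X:\varphi(x)\cap U\neq\emptyset\}$ is open in $X$ for every open $U\subset Y$. A single-valued mapping $g:X\to Y$ is an $r$-selection ($r>0$) for $\varphi:X\to 2^Y$ if $d(g(x),\varphi(x))<r$ for every $x\in X$. $\tau$-PF-normality: the star of $A\subset X$ with respect to a cover $\mathscr{U}$ of $X$ is $\operatorname{St}(A,\mathscr{U})=\bigcup\{U\in\mathscr{U}:A\cap U\neq\emptyset\}$. A cover $\mathscr{U}$ is a star-refinement of a cover $\mathscr{V}$ if for each $U\in\mathscr{U}$ there is $V\in\mathscr{V}$ with $\operatorname{St}(U,\mathscr{U})\subset V$. A normal sequence is a sequence $\{\mathscr{U}_n:n\in\mathbb{N}\}$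 of open covers of $X$ such that $\mathscr{U}_{n+1}$ is a star-refinement of $\mathscr{U}_n$ for each $n$. An open cover $\mathscr{U}$ is normal if $\mathscr{U}=\mathscr{U}_1$ for some normal sequence $\{\mathscr{U}_n:n\in\mathbb{N}\}$ of open covers of $X$. A $T_1$-space $X$ is $\tau$-PF-normal if every point-finite open cover $\mathscr{U}$ of $X$ with $|\mathscr{U}|\leq\tau$ is normal. *)

(* Defs.v *)
From HB Require Import structures.
From mathcomp Require Import all_boot all_order all_algebra.
From mathcomp Require Import all_classical all_reals all_analysis.

Set Implicit Arguments.
Unset Strict Implicit.
Unset Printing Implicit Defensive.

Import Order.TTheory GRing.Theory Num.Theory.
Import numFieldNormedType.Exports.

Local Open Scope classical_set_scope.
Local Open Scope card_scope.
Local Open Scope ring_scope.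

(* Cardinals are represented by types: an infinite cardinal tau is a type with
   [infinite_set [set: tau]], and |A| <= tau reads [A #<= [set: tau]]. *)

Definition weight_le (Y : topologicalType) (tau : Type) : Prop :=
  exists2 B : set (set Y), basis B & B #<= [set: tau].

Definition open_cover (X : topologicalType) (U : set (set X)) : Prop :=
  U `<=` open /\ \bigcup_(A in U) A = [set: X].

Definition point_finite (X : Type) (U : set (set X)) : Prop :=
  forall x, finite_set [set A | U A /\ A x].

Definition star (X : Type) (A : set X) (U : set (set X)) : set X :=
  \bigcup_(B in [set B | U B /\ A `&` B !=set0]) B.

Definition star_refinement (X : Type) (U V : set (set X)) : Prop :=
  forall A, U A -> exists2 B, V B & star A U `<=` B.

Definition normal_sequence (X : topologicalType) (U : nat -> set (set X)) :
    Prop :=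
  (forall n, open_cover (U n)) /\ (forall n, star_refinement (U n.+1) (U n)).

(* Sequences start at index 0 instead of 1. *)
Definition normal_cover (X : topologicalType) (U : set (set X)) : Prop :=
  exists2 V : nat -> set (set X), normal_sequence V & U = V 0%N.

Definition PF_normal (tau : Type) (X : topologicalType) : Prop :=
  accessible_space X /\
  forall U : set (set X), open_cover U -> point_finite U ->
    U #<= [set: tau] -> normal_cover U.

Definition lsc (X Y : topologicalType) (phi : X -> set Y) : Prop :=
  forall U : set Y, open U -> open [set x | phi x `&` U !=set0].

(* For P = set0 this is 0 by the convention inf set0 = 0; it is only relevant
   for non-empty P. *)
Definition dist_set (R : realType) (Y : normedModType R) (p : Y) (P : set Y) :
    R :=
  inf [set `|p - q| | q in P].

Definition convex_hull (R : realType) (Y : normedModType R) (A : set Y) :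
    set Y :=
  smallest (@convex_set R Y) A.

Definition paraconvex (R : realType) (Y : normedModType R) (alpha : R)
    (P : set Y) : Prop :=
  forall (r : R) (p : Y), 0 < r -> dist_set p P < r ->
    forall q, convex_hull (ball p r `&` P) q -> dist_set q P <= alpha * r.

Definition compact_paraconvex (R : realType) (Y : normedModType R) (alpha : R) :
    set (set Y) :=
  [set P | [/\ P !=set0, compact P & paraconvex alpha P]].

Definition r_selection (R : realType) (X : Type) (Y : normedModType R) (r : R)
    (phi : X -> set Y) (g : X -> Y) : Prop :=
  forall x, dist_set (g x) (phi x) < r.

(* Main.v *)
Require Import Defs.
From HB Require Import structures.
From mathcomp Require Import all_boot all_order all_algebra.
From mathcomp Require Import all_classical all_reals all_analysis.
From mathcomp Require Import finmap wochoice ring lra.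

Set Implicit Arguments.
Unset Strict Implicit.
Unset Printing Implicit Defensive.

Import Order.TTheory GRing.Theory Num.Theory.
Import numFieldNormedType.Exports.

Local Open Scope classical_set_scope.
Local Open Scope card_scope.
Local Open Scope ring_scope.

(** Why the theorem holds.

    Suppose that [g] is continuous and [d(g(x), phi(x)) < rho(x)] with [rho]
    continuous.  The values [phi(x) /\ B(g(x), rho(x))] are non-empty and depend
    lower semi-continuously on [x].  If [g'] is a continuous map that stays
    within [e] of their convex hulls, then [g'] is uniformly close to [g], and
    paraconvexity bounds [d(g'(x), phi(x))] by [alpha rho(x) + e]
    ([paraconvex_step]).  Take [beta] strictly between [alpha] and [1], and [e]
    of the size of [(beta - alpha) rho]: the error shrinks by the factor [beta]
    at each step, the maps form a geometric Cauchy sequence, and the limit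
    takes its values in the closed sets [phi(x)]
    ([paraconvex_selection_near]).  This gives (b).  For (a) the process starts
    at [g = 0]; no constant bounds the distances from [0] to the values, but a
    continuous function does ([continuous_norm_majorant]), and the iteration
    works with a variable [rho] as long as it is bounded away from [0].

    It remains to find continuous maps close to the convex hulls of a lower
    semi-continuous [psi] whose values lie in compact sets
    ([approximate_hull_selection]).  Paracompactness of metric spaces gives a
    locally finite open cover [(V_i)] of [Y] by small sets, indexed by a base of
    [Y] and hence by at most [tau] indices.  A compact set meets only finitely
    many [V_i], so the open sets [U_i = {x | psi(x) meets V_i}] form a
    point-finite cover of [X]; this is where compactness of the values is used.
    PF-normality makes the cover [(U_i)] normal.  Two star-refinements of it
    yield a locally finite shrinking together with a further shrinking whose
    closures lie inside the first one, and since [X] is normal, Urysohn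
    functions give a partition of unity subordinate to [(U_i)]
    ([locally_finite_bumps]).  Averaging with it points that are near the [V_i]
    gives the required map ([convex_hull_selection]).

    The same averaging, applied to the norms of these points instead of the
    points, produces the continuous majorant needed in (a). *)

(** * Paracompactness of normed spaces *)

Lemma subsingleton_finite (T : Type) (A : set T) :
  (forall x y, A x -> A y -> x = y) -> finite_set A.
Proof.
move=> A1; have [->|/set0P[x Ax]] := eqVneq A set0; first exact: finite_set0.
by apply: (sub_finite_set _ (finite_set1 x)) => y Ay; exact: A1.
Qed.

(** The construction is Rudin's proof of Stone's theorem, with the index set
    well ordered by [le]. *)
Section stone.
Context {R : realType} {Y : normedModType R} {I : eqType} (le : rel I).
Variable C : I -> set Y.

Definition first_index (i : I) (y : Y) := C i y /\ forall j, C j y -> le i j.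

Definition radius (n : nat) : R := 2^-1 ^+ n.

(** The sets of stage [n], where [T] is what the earlier stages have covered.
    The factor [3] separates the pieces of different indices: their centres are
    at distance at least [3 * radius n], and each piece extends its centres by
    only [radius n]. *)
Definition rudin_piece (n : nat) (T : set Y) (i : I) : set Y :=
  \bigcup_(y in [set y | [/\ first_index i y, ~ T y &
     ball y (3 * radius n) `<=` C i]]) ball y (radius n).

Fixpoint rudin_covered (n : nat) : set Y :=
  if n is m.+1 then
    rudin_covered m `|` \bigcup_i rudin_piece m (rudin_covered m) i
  else set0.

Definition rudin_layer (n : nat) (i : I) : set Y :=
  rudin_piece n (rudin_covered n) i.

Lemma radius_gt0 n : 0 < radius n.
Proof. by rewrite exprn_gt0// invr_gt0. Qed.

Lemma radiusS n : radius n = 2 * radius n.+1.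
Proof. by rewrite /radius exprS mulrA mulfV ?mul1r. Qed.

Lemma radius_le m n : (m <= n)%N -> radius n <= radius m.
Proof.
by move=> mn; apply: ler_wiXn2l => //; rewrite ?invr_ge0 ?invf_le1 ?ler1n.
Qed.

Lemma rudin_coveredP n y :
  rudin_covered n y <-> exists2 m, (m < n)%N & exists i, rudin_layer m i y.
Proof.
elim: n => [|n IH]; first by split=> // -[].
split=> [[/IH[m mn mi]|[i _ ni]]|[m]].
- by exists m => //; exact: ltnW.
- by exists n => //; exists i.
rewrite ltnS leq_eqVlt => /orP[/eqP->[i ni]|mn mi]; first by right; exists i.
by left; apply/IH; exists m.
Qed.

Lemma rudin_layer_sub n i : rudin_layer n i `<=` C i.
Proof.
move=> z [y [_ _ yC] yz]; apply: yC; apply: le_ball yz.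
by have := radius_gt0 n; lra.
Qed.

Lemma open_rudin_layer n i : open (rudin_layer n i).
Proof. by apply: bigcup_open => y _; exact: ball_open. Qed.

Lemma rudin_layer_cover : well_order le -> (forall i, open (C i)) ->
  \bigcup_i C i = [set: Y] -> forall y, exists n i, rudin_layer n i y.
Proof.
move=> wo oC cC y.
have [j _ jy] : (\bigcup_i C i) y by rewrite cC.
have [|i [[iA imin] _]] := wo [pred i | `[< C i y >]].
  by exists j; apply/asboolP.
have iy : C i y by apply/asboolP.
have fi : first_index i y.
  by split=> // k ky; apply: imin; apply/asboolP.
have : nbhs y (C i) by apply: open_nbhs_nbhs.
move=> /nbhs_ballP[e /= e0 eC].
have [n ne] : exists n, 3 * radius n < e.
  have : (fun n => radius n) @ \oo --> (0 : R).
    by apply: cvg_expr; rewrite ger0_norm ?invr_ge0// invf_lt1 ?ltr1n.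
  have e3 : 0 < e / 3 by rewrite divr_gt0.
  move=> /cvgr0Pnorm_lt/(_ _ e3)[n _ /(_ n (leqnn n))].
  by rewrite ger0_norm ?ltW ?radius_gt0 // => ?; exists n; lra.
have [/rudin_coveredP[m _ [k]]|yn] := pselect (rudin_covered n y).
  by exists m, k.
exists n, i, y; last by apply: ballxx; exact: radius_gt0.
by split=> //; apply: subset_trans eC; exact/le_ball/ltW.
Qed.

(** If [i] precedes [j], the large ball around a centre of the [i]-th piece lies
    in [C i], while a centre of the [j]-th piece, whose first index is [j], lies
    outside [C i]. *)
Lemma rudin_layer_apart n i j p q : well_order le ->
  rudin_layer n i p -> rudin_layer n j q -> i != j -> radius n <= `|p - q|.
Proof.
move=> wo; wlog ij : i j p q / le i j.
  have /wo_chainW tot : wo_chain le predT by apply: withinW.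
  move=> th ip jq ne; have /orP[ij|ji] := tot i j isT isT.
    exact: (th i j).
  by rewrite distrC; apply: (th j i) => //; rewrite eq_sym.
move=> [y [[iy _] _ yC] py] [z [[_ zmin] _ _] zq] ne.
have : ~ C i z.
  move=> /zmin ji; have /wo_chain_antisymmetric anti : wo_chain le predT.
    exact: withinW.
  by move/eqP: ne; apply; apply: anti => //; rewrite ij ji.
move=> Niz; rewrite leNgt; apply/negP => pq; apply/Niz/yC.
move: py zq; rewrite -!ball_normE /= => py zq.
have -> : y - z = (y - p) + (p - q) + (q - z) by rewrite !subrKA.
rewrite (distrC z) in zq.
have := ler_normD (y - p + (p - q)) (q - z).
have := ler_normD (y - p) (p - q).
lra.
Qed.

(** Centres of later stages avoid all of the layer [n], in particular the ball
    of radius [radius j] around [y], and later layers stay within [radius m] of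
    their centres. *)
Lemma rudin_layer_far n j i m y : ball y (radius j) `<=` rudin_layer n i ->
  (n + j < m)%N -> forall k z, rudin_layer m k z ->
  radius (n + j).+1 <= `|y - z|.
Proof.
move=> yj njm k z [p [_ Tp _]]; rewrite -ball_normE /= distrC => pz.
rewrite leNgt; apply/negP => yz; apply: Tp.
apply/rudin_coveredP; exists n.
  by apply: leq_trans njm; rewrite ltnS leq_addr.
exists i; apply: yj; rewrite -ball_normE /=.
have -> : y - p = (y - z) + (z - p) by rewrite subrKA.
have := ler_normD (y - z) (z - p).
have := radius_le njm; have := radius_le (leq_addl n j).
rewrite (radiusS (n + j)); lra.
Qed.

(** Around a point of the layer [n], a small enough ball misses all late layers,
    and it meets each of the finitely many others in at most one piece. *)
Lemma rudin_locally_finite : well_order le -> (forall i, open (C i)) ->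
  \bigcup_i C i = [set: Y] -> forall y : Y, exists2 N : set Y, nbhs y N &
  finite_set [set i | (\bigcup_n rudin_layer n i) `&` N !=set0].
Proof.
move=> wo oC cC y; have [n [i iy]] := rudin_layer_cover wo oC cC y.
have : nbhs y (rudin_layer n i).
  by apply: open_nbhs_nbhs; split=> //; exact: open_rudin_layer.
move=> /nbhs_ballP[e /= e0 eL].
have [j je] : exists j, radius j < e.
  have : (fun n => radius n) @ \oo --> (0 : R).
    by apply: cvg_expr; rewrite ger0_norm ?invr_ge0// invf_lt1 ?ltr1n.
  move=> /cvgr0Pnorm_lt/(_ _ e0)[j _ /(_ j (leqnn j))].
  by rewrite ger0_norm ?ltW ?radius_gt0 // => ?; exists j.
have jL : ball y (radius j) `<=` rudin_layer n i.
  by apply: subset_trans eL; exact/le_ball/ltW.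
exists (ball y (radius (n + j).+2)).
  by apply: nbhsx_ballx; exact: radius_gt0.
have r0 := radius_gt0 (n + j).+2.
apply: (@sub_finite_set _ _ (\bigcup_(m in `I_(n + j).+1)
    [set k | rudin_layer m k `&` ball y (radius (n + j).+2) !=set0])).
  move=> k [z [[m _ kz] yz]].
  have [mnj|njm] := ltnP m (n + j).+1.
    by exists m => //; exists z.
  have := rudin_layer_far jL njm kz; move: yz; rewrite -ball_normE /=.
  rewrite (radiusS (n + j).+1); lra.
apply: bigcup_finite; first exact: finite_II.
move=> m /= mnj; apply: subsingleton_finite => k l [p [kp yp]] [q [lq yq]].
apply/eqP/negPn/negP => kl; have := rudin_layer_apart wo kp lq kl.
move: yp yq; rewrite -!ball_normE /= => yp yq.
have -> : p - q = - (y - p) + (y - q) by rewrite opprB addrA subrK.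
have := ler_normD (- (y - p)) (y - q); rewrite normrN.
have : radius (n + j).+1 <= radius m by apply: radius_le; exact: ltnW.
rewrite (radiusS (n + j).+1); lra.
Qed.

End stone.

(** The refinement keeps the index set of the given cover: the pieces of all
    stages with the same index are united.  Hence its size is bounded by that of
    the given cover. *)
Lemma stone_locally_finite_refinement (R : realType) (Y : normedModType R)
    (I : eqType) (C : I -> set Y) :
  (forall i, open (C i)) -> \bigcup_i C i = [set: Y] ->
  exists V : I -> set Y, [/\ forall i, open (V i), forall i, V i `<=` C i,
    \bigcup_i V i = [set: Y] & forall y : Y, exists2 N : set Y, nbhs y N &
      finite_set [set i | V i `&` N !=set0]].
Proof.
move=> oC cC; have [le wo] := well_ordering_principle I.
exists (fun i => \bigcup_n rudin_layer le C n i); split.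
- by move=> i; apply: bigcup_open => n _; exact: open_rudin_layer.
- by move=> i; apply: bigcup_sub => n _; exact: rudin_layer_sub.
- rewrite -subTset => y _; have [n [i iy]] := rudin_layer_cover wo oC cC y.
  by exists i => //; exists n.
- exact: rudin_locally_finite.
Qed.

Lemma compact_meets_finitely_many (Y : ptopologicalType) (I : choiceType)
    (V : I -> set Y) (K : set Y) : 
  (forall y : Y, exists2 N : set Y, nbhs y N &
    finite_set [set i | V i `&` N !=set0]) ->
  compact K -> finite_set [set i | V i `&` K !=set0].
Proof.
move=> lf; rewrite compact_cover => cK.
have [N] := choice (fun y => let: ex_intro2 N a b := lf y in
  ex_intro (fun N => nbhs y N /\ _) N (conj a b)).
move=> Nlf.
have [|y Ky|D DK KD] := cK Y K (fun y => (N y)°).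
- by move=> y _; exact: open_interior.
- by exists y => //; exact: (Nlf y).1.
have fin : finite_set
    (\bigcup_(y in [set` D]) [set i | V i `&` N y !=set0]).
  by apply: bigcup_finite => // y _; exact: (Nlf y).2.
apply: sub_finite_set fin => i [z [iz Kz]]; have [y Dy yz] := KD _ Kz.
by exists y => //; exists z; split=> //; exact: interior_subset.
Qed.

(** * Partitions of unity on PF-normal spaces *)

(** For disjoint closed sets, the cover by their two complements is normal, and
    their stars in a star-refinement are disjoint: a common point would give a
    star that meets both sets. *)
Lemma PF_normal_normal_space (R : realType) (tau : Type) (X : topologicalType) :
  infinite_set [set: tau] -> PF_normal tau X -> normal_space X.
Proof.
move=> inf [_ PF]; apply/(@normal_openP R X) => A B cA cB AB0.
have fin2 : finite_set [set ~` A; ~` B] by exact: finite_set2.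
have [|||V [cV sV] V0] := PF [set ~` A; ~` B].
- split; first by move=> _ [->|->]; exact: closed_openC.
  rewrite -subTset => x _.
  have [Ax|nAx] := pselect (A x); last by exists (~` A) => //; left.
  by exists (~` B); [right|move=> Bx; rewrite -[False]/(set0 x) -AB0].
- by move=> x; apply: sub_finite_set fin2 => W [].
- apply: (@card_le_trans _ _ _ [set: nat]); last exact/infiniteP.
  exact: finite_set_countable.
have sub_star W (F : set X) x : F x -> W x -> V 1%N W -> star F (V 1%N) x.
  by move=> Fx Wx VW; exists W => //; split=> //; exists x.
have openV n W : V n W -> open W by exact: (cV n).1.
exists (star A (V 1%N)), (star B (V 1%N)); split.
- by apply: bigcup_open => W [/openV].
- by apply: bigcup_open => W [/openV].
- move=> x Ax; have [W VW Wx] : (\bigcup_(W in V 1%N) W) x by rewrite (cV _).2.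
  exact: (sub_star W).
- move=> x Bx; have [W VW Wx] : (\bigcup_(W in V 1%N) W) x by rewrite (cV _).2.
  exact: (sub_star W).
rewrite -subset0 => x [[W [VW [a [Aa Wa]]] Wx] [W' [VW' [b [Bb Wb]]] Wx']].
have [F] := sV 0%N _ VW; rewrite -V0 => FAB sF.
have Fa : F a by apply: sF; exact: (sub_star W).
have Fb : F b by apply: sF; exists W' => //; split=> //; exists x.
by case: FAB => FE; rewrite FE in Fa Fb; [exact: Fa|exact: Fb].
Qed.

Section core.
Context {X : topologicalType}.
Implicit Types (V W : set (set X)) (A U N : set X).

(** The part of [U] that is uniformly inside [U], as measured by [V]. *)
Definition core V U : set X :=
  \bigcup_(A in [set A | V A /\ star A V `<=` U]) A.

Lemma open_core V U : open_cover V -> open (core V U).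
Proof. by move=> [oV _]; apply: bigcup_open => A [/oV]. Qed.

(** This turns point-finiteness into local finiteness: if a member of [V]
    around [x] meets the cores of some sets, then [x] belongs to all of these
    sets. *)
Lemma core_near V U N : V N -> N `&` core V U !=set0 -> N `<=` U.
Proof.
move=> VN [z [Nz [A [VA AU] Az]]] x Nx; apply: AU.
by exists N => //; split=> //; exists z.
Qed.

Lemma closure_core V U : open_cover V -> closure (core V U) `<=` U.
Proof.
move=> [oV cV] x cx.
have [N VN Nx] : (\bigcup_(A in V) A) x by rewrite cV.
apply: (@core_near V U N) => //; rewrite setIC.
by apply: cx; apply: open_nbhs_nbhs; split=> //; exact: oV.
Qed.

Lemma core_core_cover V W (T : set (set X)) : open_cover W ->
  star_refinement W V -> star_refinement V T ->
  forall x, exists2 A, T A & core W (core V A) x.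
Proof.
move=> [_ cW] WV VT x; have [B WB Bx] : (\bigcup_(A in W) A) x by rewrite cW.
have [C VC BC] := WV _ WB; have [A TA CA] := VT _ VC.
by exists A => //; exists B => //; split=> // y /BC Cy; exists C.
Qed.

End core.

(** The sets [core (V 1) (U i)] are a locally finite shrinking of the [U i].
    They contain the closures of the sets [core (V 2) (core (V 1) (U i))], which
    still cover the space; the bumps are Urysohn functions between the two. *)
Lemma locally_finite_bumps (R : realType) (tau : Type) (X : topologicalType)
    (I : Type) (D : set I) (U : I -> set X) :
  infinite_set [set: tau] -> PF_normal tau X -> D #<= [set: tau] ->
  (forall i, D i -> open (U i)) -> \bigcup_(i in D) U i = [set: X] ->
  (forall x, finite_set [set i | D i /\ U i x]) ->
  exists k : I -> X -> R, [/\ forall i, continuous (k i),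
    forall i x, 0 <= k i x, forall i x, k i x != 0 -> D i,
    forall x, exists i, k i x != 0 &
    forall x, \forall z \near x, forall i, k i z != 0 -> U i x].
Proof.
move=> inf PF Dtau oU cU fU.
have [|||V [cV sV] V0] := PF.2 (U @` D).
- split; first by move=> _ [i Di <-]; exact: oU.
  by rewrite bigcup_image.
- move=> x; apply: sub_finite_set (finite_image U (fU x)).
  by move=> _ [[i Di <-] Uix]; exists i.
- exact: card_le_trans (card_image_le U D) Dtau.
have normX := PF_normal_normal_space R inf PF.
pose H i := core (V 1%N) (U i); pose G i := core (V 2%N) (H i).
have sep i : exists f : X -> R, [/\ continuous f, forall x, 0 <= f x,
    forall x, f x != 0 -> H i x & forall x, G i x -> f x != 0].
  have /(uniform_separatorP (R := R))[f [cf f01 f0 f1]] :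
      uniform_separator (~` H i) (closure (G i)).
    apply: normal_uniform_separator => //.
    - exact/open_closedC/open_core.
    - exact: closed_closure.
    - by rewrite -subset0 => x [nHx cG]; exact/nHx/(closure_core (cV 2%N) cG).
  exists f; split=> //.
  - by move=> x; have := f01 (f x) (ex_intro2 _ _ x Logic.I erefl);
      rewrite /= in_itv/= => /andP[].
  - by move=> x /eqP fx; apply: contrapT => Hx; apply/fx/f0; exists x.
  - move=> x Gx; rewrite (f1 (f x)) ?oner_eq0//; exists x => //.
    exact: subset_closure.
have [k kP] := choice sep.
exists (fun i => if `[< D i >] then k i else cst 0); split.
- move=> i; case: asboolP => _; last exact: cst_continuous.
  by case: (kP i).
- by move=> i x; case: asboolP => _ //; case: (kP i).
- by move=> i x; case: asboolP => //; rewrite eqxx.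
- move=> x; have := core_core_cover (cV 2%N) (sV 1%N) (sV 0%N) x.
  rewrite -V0 => -[_ [i Di <-] Gx]; exists i.
  by rewrite (asboolT Di); case: (kP i) => _ _ _; exact.
- move=> x; have [N VN Nx] : (\bigcup_(A in V 1%N) A) x by rewrite (cV _).2.
  have : nbhs x N by apply: open_nbhs_nbhs; split=> //; exact: (cV 1%N).1.
  apply: filterS => z Nz i; case: asboolP => [_|]; last by rewrite eqxx.
  case: (kP i) => _ _ kH _ /kH Hz.
  by apply: (core_near VN) Nx; exists z.
Qed.

Lemma convex_setP (R : realType) (Z : lmodType R) (C : set Z) :
  @convex_set R Z C <-> forall s t x y, 0 <= s -> 0 <= t -> s + t = 1 ->
    C x -> C y -> C (s *: x + t *: y).
Proof.
split=> [cC s t x y s0 t0 st Cx Cy|cC x y l].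
  have s1 : s <= 1 by rewrite -st lerDl.
  have /set_mem := cC x y (Itv01 s0 s1) (mem_set Cx) (mem_set Cy).
  by rewrite /convex.conv/= /unstable.onem -st addrAC subrr add0r.
move=> /set_mem Cx /set_mem Cy; apply/mem_set.
apply: cC => //; first exact: unstable.onem_ge0.
by rewrite /unstable.onem addrC subrK.
Qed.

Lemma convex_set_sum (R : realType) (Z : lmodType R) (C : set Z) (I : Type)
    (s : seq I) (k : I -> R) (y : I -> Z) :
  @convex_set R Z C ->
  (forall i, 0 <= k i) -> (forall i, k i != 0 -> C (y i)) ->
  \sum_(i <- s) k i != 0 ->
  C ((\sum_(i <- s) k i)^-1 *: \sum_(i <- s) k i *: y i).
Proof.
move=> /convex_setP cC k0 kC.
(* Tails of [s] may have total weight 0, where the barycentre [z] has to be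
   left unconstrained for the induction to go through. *)
suff [z [-> Cz] S0] : exists z,
    \sum_(i <- s) k i *: y i = (\sum_(i <- s) k i) *: z /\
    (\sum_(i <- s) k i != 0 -> C z).
  by rewrite scalerA mulVf // scale1r; exact: Cz.
elim: s => [|i s [z [sz Cz]]]; first by exists 0; rewrite !big_nil scaler0 eqxx.
rewrite !big_cons sz; set S := \sum_(j <- s) k j in Cz *.
have S0 : 0 <= S by apply: sumr_ge0.
have [ki0|ki0] := eqVneq (k i) 0; first by exists z; rewrite ki0 scale0r !add0r.
have [S0'|S0'] := eqVneq S 0.
  by exists (y i); rewrite S0' scale0r !addr0; split=> // _; exact: kC.
have kS : 0 < k i + S by rewrite ltr_wpDr // lt0r ki0 k0.
have kSn : k i + S != 0 by rewrite gt_eqF.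
exists ((k i / (k i + S)) *: y i + (S / (k i + S)) *: z); split.
  by rewrite scalerDr !scalerA !(mulrCA (k i + S)) divff // !mulr1.
move=> _; apply: cC.
- by rewrite divr_ge0 // ltW.
- by rewrite divr_ge0 // ltW.
- by rewrite -mulrDl divff.
- exact: kC.
- exact: Cz.
Qed.

(** The average of the [y i], weighted by the bumps: around each point it is a
    finite sum over a fixed set of indices, hence continuous. *)
Lemma convex_hull_selection (R : realType) (tau : Type) (X : topologicalType)
    (I : choiceType) (D : set I) (U : I -> set X) (Z : normedModType R)
    (y : I -> Z) :
  infinite_set [set: tau] -> PF_normal tau X -> D #<= [set: tau] ->
  (forall i, D i -> open (U i)) -> \bigcup_(i in D) U i = [set: X] ->
  (forall x, finite_set [set i | D i /\ U i x]) ->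
  exists p : X -> Z, continuous p /\
    forall x, convex_hull [set y i | i in [set i | D i /\ U i x]] (p x).
Proof.
move=> inf PF Dtau oU cU fU.
have [k [ck k0 kD k1 kU]] := locally_finite_bumps R inf PF Dtau oU cU fU.
pose F x : {fset I} := fset_set [set i | D i /\ U i x].
pose num x := \sum_(i \in D) k i x *: y i.
pose den x := \sum_(i \in D) k i x.
have loc x : \forall z \near x, forall i, i \notin F x -> k i z = 0.
  near=> z => i; apply: contraNeq => ki0.
  rewrite in_fset_set //; apply/mem_set; split; first exact: kD ki0.
  by move: i ki0; near: z; exact: kU.
have FD x i : i \in F x -> D i.
  by rewrite in_fset_set // => /set_mem[].
have sumF (V : nmodType) (h : I -> V) x : (forall i, i \notin F x -> h i = 0) ->
    \sum_(i \in D) h i = \sum_(i <- F x) h i.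
  move=> h0; have := @fsbigE _ _ +%R I D (F x) h (fset_uniq _).
  move=> -> //; [|by move=> i /FD|by move=> i _; exact: h0].
  rewrite big_seq_cond [RHS]big_seq; apply: eq_bigl => i.
  by case: (boolP (i \in F x)) => //= iF; rewrite mem_set //; exact: FD iF.
have numE x z : (forall i, i \notin F x -> k i z = 0) ->
    num z = \sum_(i <- F x) k i z *: y i.
  by move=> kz; apply: sumF => i iF; rewrite kz // scale0r.
have denE x z : (forall i, i \notin F x -> k i z = 0) ->
    den z = \sum_(i <- F x) k i z.
  exact: sumF.
have cnum : continuous num.
  move=> x; have nx := nbhs_singleton (loc x).
  rewrite /continuous_at (numE x x nx).
  apply: (@cvg_trans _ (\sum_(i <- F x) k i z *: y i @[z --> x])).
    apply: near_eq_cvg; near=> z; rewrite (numE x z) //; near: z; exact: loc.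
  apply: cvg_big => [|i _]; first exact: add_continuous.
  by apply: cvgZr_tmp; exact: ck.
have cden : continuous den.
  move=> x; have nx := nbhs_singleton (loc x).
  rewrite /continuous_at (denE x x nx).
  apply: (@cvg_trans _ (\sum_(i <- F x) k i z @[z --> x])).
    apply: near_eq_cvg; near=> z; rewrite (denE x z) //; near: z; exact: loc.
  by apply: cvg_big => [|i _]; [exact: add_continuous|exact: ck].
have den0 x : den x != 0.
  have nx := nbhs_singleton (loc x); rewrite (denE x x nx).
  have [i kix] := k1 x; rewrite psumr_neq0 //; apply/hasP; exists i.
    by apply: contraNT kix => /nx ->.
  by rewrite lt0r kix k0.
exists (fun x => (den x)^-1 *: num x); split.
  move=> x; apply: cvgZ; last exact: cnum.
  by apply: cvgV => //; exact: cden.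
move=> x; have nx := nbhs_singleton (loc x).
rewrite (numE x x nx) (denE x x nx) => C [cC yC].
apply: convex_set_sum => //; last by rewrite -denE.
move=> i ki0; apply: yC; exists i => //; split; first exact: kD ki0.
by move: i ki0; exact: (nbhs_singleton (kU x)).
Unshelve. all: by end_near.
Qed.

(** * Distances and convex hulls *)

Section distance.
Context {R : realType} {Y : normedModType R}.
Implicit Types (A C P : set Y) (p q : Y) (e r : R).

Lemma convex_hull_convex A : @convex_set R Y (convex_hull A).
Proof.
apply/convex_setP => s t x y s0 t0 st Ax Ay C [cC AC].
by move/convex_setP: (cC); apply => //; [exact: Ax|exact: Ay].
Qed.

Lemma convex_hull_sub A C : @convex_set R Y C -> A `<=` C ->
  convex_hull A `<=` C.
Proof. exact: smallest_sub. Qed.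

Definition thickening A e : set Y :=
  [set p | exists2 q, A q & `|p - q| < e].

Lemma convex_thickening A e :
  @convex_set R Y A -> @convex_set R Y (thickening A e).
Proof.
move=> /convex_setP cA; apply/convex_setP => s t x y s0 t0 st.
move=> [a Aa xa] [b Ab yb]; exists (s *: a + t *: b); first exact: cA.
rewrite opprD addrACA -!scalerBr.
apply: le_lt_trans (ler_normD _ _) _; rewrite !normrZ !ger0_norm //.
have -> : e = s * e + t * e by rewrite -mulrDl st mul1r.
have [s_eq|s_neq] := eqVneq s 0.
  have t1 : t = 1 by rewrite -st s_eq add0r.
  by rewrite s_eq t1 !mul0r !add0r !mul1r.
apply: ltr_leD; first by rewrite ltr_pM2l // lt0r s_neq.
by apply: ler_wpM2l => //; exact: ltW.
Qed.

Lemma dist_set_lt p P r : P !=set0 -> dist_set p P < r ->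
  exists2 q, P q & `|p - q| < r.
Proof.
move=> [q Pq] /inf_lt[|_ [z Pz <-] zr]; last by exists z.
by exists `|p - q|, q.
Qed.

Lemma dist_set_le p q P : P q -> dist_set p P <= `|p - q|.
Proof.
move=> Pq; apply: ge_inf; last by exists q.
by exists 0 => _ [z _ <-].
Qed.

Lemma dist_set_triangle p q P : P !=set0 ->
  dist_set p P <= `|p - q| + dist_set q P.
Proof.
move=> P0; apply/ler_addgt0Pr => e e0.
have [z Pz qz] : exists2 z, P z & `|q - z| < dist_set q P + e.
  by apply: dist_set_lt => //; rewrite ltrDl.
apply: le_trans (dist_set_le p Pz) _.
rewrite -addrA; apply: le_trans (ler_distD q _ _) _.
by rewrite lerD2l ltW.
Qed.

Lemma closed_dist_set p P : closed P -> P !=set0 ->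
  (forall e, 0 < e -> dist_set p P <= e) -> P p.
Proof.
move=> cP P0 pP; apply: cP => N /nbhs_ballP[e /= e0 eN].
have [z Pz pz] : exists2 z, P z & `|p - z| < e.
  apply: dist_set_lt => //; apply: le_lt_trans (pP (e / 2) _) _; lra.
by exists z; split=> //; apply: eN; rewrite -ball_normE.
Qed.

End distance.

(** * Approximate selections of convex hulls *)

(** The indices in [D] are the members of a base that are contained in some ball
    of radius [e], and [c i] is the centre of such a ball. *)
Lemma fine_locally_finite_cover (R : realType) (tau : Type)
    (Y : normedModType R) (e : R) : weight_le Y tau -> 0 < e ->
  exists (D : set (set Y)) (V : set Y -> set Y) (c : set Y -> Y),
  [/\ D #<= [set: tau], forall i, open (V i), forall i, V i !=set0 -> D i,
      forall i y, V i y -> `|c i - y| < e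
    & \bigcup_i V i = [set: Y] /\
      forall K, compact K -> finite_set [set i | V i `&` K !=set0]].
Proof.
move=> [B [oB bB] Btau] e0.
pose D := [set b | B b /\ exists c, forall y, b y -> `|c - y| < e].
have [||V [oV VC cV lfV]] :=
    @stone_locally_finite_refinement R Y (set Y) (fun b => [set y | D b /\ b y]).
- move=> b; have [Db|nDb] := pselect (D b).
    have -> : [set y | D b /\ b y] = b by apply/seteqP; split=> y // -[].
    by apply: oB; case: Db.
  have -> : [set y | D b /\ b y] = set0 by apply/seteqP; split=> y // -[].
  exact: open0.
- rewrite -subTset => y _.
  have [b [Bb yb] be] := bB y _ (nbhsx_ballx y e e0).
  exists b => //; split=> //; split=> //; exists y => z /be.
  by rewrite -ball_normE.
have [c cP] : {c : set Y -> Y &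
    forall b, D b -> forall y, b y -> `|c b - y| < e}.
  apply: (@choice _ _ (fun b c => D b -> forall y, b y -> `|c - y| < e)) => b.
  have [[_ [c bc]]|nDb] := pselect (D b); first by exists c.
  by exists 0.
exists D, V, c; split=> //.
- by apply: card_le_trans Btau; apply: subset_card_le => b [].
- by move=> b [y /VC[]].
- by move=> b y /VC[Db]; exact: cP.
- by split=> // K; exact: compact_meets_finitely_many.
Qed.

(** The map [h] is arbitrary because only its values at the chosen points [c i]
    near the members of the cover are averaged.  Taking [h] to be the identity
    gives approximate selections, while a function of the norm gives real
    majorants. *)
Lemma approximate_hull_selection (R : realType) (tau : Type)
    (Y Z : normedModType R) (X : topologicalType) (psi : X -> set Y)
    (h : Y -> Z) (e : R) :
  infinite_set [set: tau] -> weight_le Y tau -> PF_normal tau X -> lsc psi ->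
  (forall x, psi x !=set0) ->
  (forall x, exists2 K, compact K & psi x `<=` K) -> 0 < e ->
  exists p : X -> Z, continuous p /\
    forall x, convex_hull (h @` thickening (psi x) e) (p x).
Proof.
move=> inf wY PF lpsi psi0 psiK e0.
have [D [V [c [Dtau oV VD Vc [cV VK]]]]] := fine_locally_finite_cover wY e0.
have [|||p [cp hp]] := @convex_hull_selection R tau X (set Y) D
    (fun i => [set x | psi x `&` V i !=set0]) Z (h \o c) inf PF Dtau.
- by move=> i _; exact: lpsi.
- rewrite -subTset => x _; have [y xy] := psi0 x.
  have [i _ Viy] : (\bigcup_i V i) y by rewrite cV.
  by exists i; [apply: VD; exists y|exists y].
- move=> x; have [K cK xK] := psiK x.
  apply: sub_finite_set (VK K cK) => i [_ [y [/xK Ky Viy]]].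
  by exists y.
exists p; split=> // x; apply: convex_hull_sub (hp x).
  exact: convex_hull_convex.
move=> _ [i [_ [y [xy Viy]]] <-] C [_ hC]; apply: hC; exists (c i) => //.
by exists y => //; exact: Vc.
Qed.

Lemma lsc_ball (R : realType) (Y : normedModType R) (X : topologicalType)
    (phi : X -> set Y) (g : X -> Y) (rho : X -> R) :
  lsc phi -> continuous g -> continuous rho ->
  lsc (fun x => ball (g x) (rho x) `&` phi x).
Proof.
move=> lphi cg crho U oU; rewrite openE => x [y [[xy phiy] Uy]].
move: xy; rewrite -ball_normE /= => xy.
pose e := (rho x - `|g x - y|) / 3.
have e0 : 0 < e by rewrite /e; lra.
have : nbhs x [set z | phi z `&` (U `&` ball y e) !=set0].
  apply: open_nbhs_nbhs; split.
    by apply: lphi; apply: openI => //; exact: ball_open.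
  by exists y; split=> //; split=> //; exact: ballxx.
have /cvgrPdist_lt/(_ _ e0) gz := cg x.
have /cvgrPdist_lt/(_ _ e0) rz := crho x.
rewrite /interior/= => Uz; near=> z.
have [w [phiw [Uw]]] : (phi z `&` (U `&` ball y e)) !=set0 by near: z.
rewrite -ball_normE /= => yw.
have gxz : `|g x - g z| < e by near: z.
have rxz : `|rho x - rho z| < e by near: z.
exists w; split=> //; split=> //=.
have := ler_distD (g x) (g z) w; have := ler_distD y (g x) w.
rewrite (distrC (g z) (g x)); move: rxz; rewrite ltr_norml => /andP[_].
by rewrite /e in yw gxz *; lra.
Unshelve. all: by end_near.
Qed.

(** Both bounds come from one approximate selection [p] of the convex hulls of
    [phi(x) /\ B(g(x), rho(x))]: these hulls lie in the ball, so [p] is near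
    [g], and by paraconvexity they are within [alpha * rho] of [phi(x)]. *)
Lemma paraconvex_step (R : realType) (tau : Type) (Y : normedModType R)
    (alpha : R) (X : topologicalType) (phi : X -> set Y) (g : X -> Y)
    (rho : X -> R) (e : R) :
  infinite_set [set: tau] -> weight_le Y tau -> PF_normal tau X -> lsc phi ->
  (forall x, compact_paraconvex alpha (phi x)) ->
  continuous g -> continuous rho -> (forall x, 0 < rho x) ->
  (forall x, dist_set (g x) (phi x) < rho x) -> 0 < e ->
  exists g' : X -> Y, [/\ continuous g',
    forall x, `|g x - g' x| < rho x + e &
    forall x, dist_set (g' x) (phi x) < alpha * rho x + e].
Proof.
move=> inf wY PF lphi phiP cg crho rho0 grho e0.
pose psi x := ball (g x) (rho x) `&` phi x.
have psi0 x : psi x !=set0.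
  have [phi0 _ _] := phiP x.
  have [y phiy gy] := dist_set_lt phi0 (grho x).
  by exists y; split=> //; rewrite -ball_normE.
have psiK x : exists2 K, compact K & psi x `<=` K.
  by have [_ cK _] := phiP x; exists (phi x) => // y [].
have [p [cp hp]] := approximate_hull_selection id inf wY PF
  (lsc_ball lphi cg crho) psi0 psiK e0.
exists p; split=> // x.
- have : thickening [set g x] (rho x + e) (p x).
    apply: convex_hull_sub (hp x).
      apply: convex_thickening; apply/convex_setP => s t _ _ _ _ st -> ->.
      by rewrite /= -scalerDl st scale1r.
    rewrite image_id => y [q [gq _] yq]; exists (g x) => //.
    move: gq; rewrite -ball_normE /= distrC => gq.
    by apply: le_lt_trans (ler_distD q _ _) _; rewrite addrC ltrD.
  by move=> [_ ->]; rewrite distrC.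
- have [q hq pq] : thickening (convex_hull (psi x)) e (p x).
    apply: convex_hull_sub (hp x).
      exact/convex_thickening/convex_hull_convex.
    rewrite image_id => y [q psiq yq]; exists q => //.
    by move=> C [_ sC]; exact: sC.
  have [phi0 _ para] := phiP x.
  have := para _ _ (rho0 x) (grho x) q hq.
  have := dist_set_triangle (p x) q phi0; lra.
Qed.

(** * Successive approximation *)

(** The convergence is only locally uniform, since [M] may be unbounded; local
    bounds on the continuous function [M] suffice for the limit to be
    continuous. *)
Lemma geometric_limit (R : realType) (Y : completeNormedModType R)
    (X : topologicalType) (g : nat -> X -> Y) (beta : R) (M : X -> R) :
  0 <= beta < 1 -> (forall n, continuous (g n)) -> continuous M ->
  (forall n x, `|g n x - g n.+1 x| <= beta ^+ n * M x) ->
  exists f : X -> Y, continuous f /\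
    forall n x, `|g n x - f x| <= beta ^+ n * (M x / (1 - beta)).
Proof.
move=> /andP[b0 b1] cg cM gM; pose A x := M x / (1 - beta).
have b1' : 0 < 1 - beta by lra.
have M0 x : 0 <= M x.
  by have := gM 0%N x; rewrite expr0 mul1r; apply: le_trans.
have A0 x : 0 <= A x by rewrite divr_ge0 // ltW.
have AM x : M x = A x * (1 - beta) by rewrite /A divfK // gt_eqF.
have tail n m x : `|g n x - g (n + m)%N x| <= beta ^+ n * A x.
  suff : `|g n x - g (n + m)%N x| <= beta ^+ n * A x * (1 - beta ^+ m).
    move=> h; apply: le_trans h _; rewrite ler_piMr //.
      by rewrite mulr_ge0 // exprn_ge0.
    by rewrite gerBl exprn_ge0.
  elim: m => [|m IH]; first by rewrite addn0 subrr normr0 expr0 subrr mulr0.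
  apply: le_trans (ler_distD (g (n + m)%N x) _ _) _.
  apply: le_trans (lerD IH _) _; first by rewrite addnS; exact: gM.
  rewrite AM exprS exprD le_eqVlt; apply/orP; left; apply/eqP; ring.
have small (a e : R) : 0 < e -> exists n, beta ^+ n * a < e.
  move=> e0; have : (beta ^+ n * a) @[n --> \oo] --> (0 * a : R).
    by apply: cvgMl; apply: cvg_expr; rewrite ger0_norm.
  rewrite mul0r => /cvgr0Pnorm_lt/(_ _ e0)[n _ /(_ n (leqnn n))] h.
  by exists n; exact: le_lt_trans (ler_norm _) h.
have cvg_g x : cvgn (g ^~ x).
  apply: cauchy_cvg; apply: cauchy_exP => e e0.
  have [n ne] := small (A x) e e0; exists (g n x).
  exists n => // m /= nm; rewrite -ball_normE /= -(subnKC nm).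
  exact: le_lt_trans (tail _ _ _) ne.
pose f x := limn (g ^~ x).
have fg n x : `|g n x - f x| <= beta ^+ n * A x.
  apply/ler_addgt0Pr => e e0.
  have /cvgrPdist_lt/(_ _ e0)[m _ /(_ (n + m)%N (leq_addl _ _))] := cvg_g x.
  rewrite -/(f x) distrC => fm.
  apply: le_trans (ler_distD (g (n + m)%N x) _ _) _.
  by apply: lerD; [exact: tail|exact: ltW].
exists f; split=> // x; apply/cvgrPdist_lt => e e0.
have L0 : 0 < A x + 1 by rewrite ltr_wpDl.
have e3 : 0 < e / 3 by rewrite divr_gt0.
have [n ne] := small (A x + 1) _ e3.
have cA : A z @[z --> x] --> A x by apply: cvgMl; exact: cM.
have Az1 : \forall z \near x, A z < A x + 1.
  by apply: (cvgr_lt (A x)) => //; rewrite ltrDl.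
have /cvgrPdist_lt/(_ _ e3) gz := cg n x.
near=> z.
have Az : A z < A x + 1 by near: z.
have gxz : `|g n x - g n z| < e / 3 by near: z.
have bz : beta ^+ n * A z <= beta ^+ n * (A x + 1).
  by rewrite ler_wpM2l ?exprn_ge0 // ltW.
have bx : beta ^+ n * A x <= beta ^+ n * (A x + 1).
  by rewrite ler_wpM2l ?exprn_ge0 // lerDl.
have := ler_distD (g n x) (f x) (f z).
have := ler_distD (g n z) (g n x) (f z).
have := fg n z; have := fg n x; rewrite (distrC (g n x) (f x)); lra.
Unshelve. all: by end_near.
Qed.

(** The lower bound [c] on [r] lets the error allowed at each step be constant
    in [x], as [approximate_hull_selection] requires. *)
Lemma paraconvex_selection_near (R : realType) (tau : Type)
    (Y : completeNormedModType R) (alpha c : R) (X : topologicalType)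
    (phi : X -> set Y) (g : X -> Y) (r : X -> R) :
  infinite_set [set: tau] -> weight_le Y tau -> PF_normal tau X -> lsc phi ->
  0 <= alpha < 1 -> (forall x, compact_paraconvex alpha (phi x)) ->
  continuous g -> continuous r -> 0 < c -> (forall x, c <= r x) ->
  (forall x, dist_set (g x) (phi x) < r x) ->
  exists f : X -> Y, [/\ continuous f, forall x, phi x (f x) &
    forall x, `|g x - f x| <= 4 / (1 - alpha) * r x].
Proof.
move=> inf wY PF lphi /andP[a0 a1] phiP cg cr c0 rc gr.
pose beta := (1 + alpha) / 2.
have b0 : 0 < beta by rewrite /beta; lra.
have b1 : beta < 1 by rewrite /beta; lra.
have ba : 0 < beta - alpha by rewrite /beta; lra.
(* [beta - alpha] is the room left by paraconvexity for the approximation error: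
   [alpha * beta ^+ n * r + beta ^+ n * (beta - alpha) * c <= beta ^+ n.+1 * r],
   as [c <= r]. *)
pose good n (u : X -> Y) := continuous u /\
  forall x, dist_set (u x) (phi x) < beta ^+ n * r x.
have step n u : exists v, good n u -> good n.+1 v /\
    forall x, `|u x - v x| <= beta ^+ n * (2 * r x).
  have [[cu ur]|nu] := pselect (good n u); last by exists u.
  have bn : 0 < beta ^+ n by rewrite exprn_gt0.
  have [|x||v [cv uv vphi]] := @paraconvex_step R tau Y alpha X phi u
    (fun x => beta ^+ n * r x) (beta ^+ n * ((beta - alpha) * c))
    inf wY PF lphi phiP cu _ _ ur.
  - by move=> x; apply: cvgMr; exact: cr.
  - by rewrite mulr_gt0 // (lt_le_trans c0).
  - by rewrite !mulr_gt0.
  have bc x : (beta - alpha) * c <= (beta - alpha) * r x.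
    by rewrite ler_wpM2l // ltW.
  have bnc x : beta ^+ n * ((beta - alpha) * c) <=
      beta ^+ n * ((beta - alpha) * r x).
    by rewrite ler_wpM2l // ltW.
  exists v => _; split; first split=> // x.
    apply: lt_le_trans (vphi x) _.
    rewrite exprS; have := bnc x; lra.
  move=> x; apply: le_trans (ltW (uv x)) _.
  apply: le_trans (lerD (lexx _) (bnc x)) _.
  rewrite -mulrDr ler_wpM2l //; first exact: ltW.
  rewrite -[X in X + _]mul1r -mulrDl ler_wpM2r //.
    by rewrite (le_trans (ltW c0)).
  lra.
have [F FP] := choice (fun nu : nat * (X -> Y) => step nu.1 nu.2).
pose G := fix G n := if n is m.+1 then F (m, G m) else g.
have goodG n : good n (G n).
  elim: n => [|n IH]; first by split=> // x; rewrite expr0 mul1r.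
  by have [] := FP (n, G n) IH.
have b01 : 0 <= beta < 1 by rewrite b1 ltW.
have [||n x|f [cf fG]] := @geometric_limit R Y X G beta (fun x => 2 * r x) b01.
- by move=> n; case: (goodG n).
- by move=> x; apply: cvgMr; exact: cr.
- by have [_] := FP (n, G n) (goodG n); apply.
have K : 2 / (1 - beta) = 4 / (1 - alpha).
  by rewrite /beta; field; rewrite !subr_eq0 !gt_eqF //; lra.
have fG' n x : `|G n x - f x| <= beta ^+ n * (4 / (1 - alpha) * r x).
  by apply: le_trans (fG n x) _; rewrite -K (mulrAC 2).
exists f; split=> // x; last by have := fG' 0%N x; rewrite expr0 mul1r.
have [phi0 cphi _] := phiP x.
apply: closed_dist_set => //; first exact: compact_closed.
move=> e e0.
pose L := r x + 4 / (1 - alpha) * r x.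
have : (beta ^+ n * L) @[n --> \oo] --> (0 * L : R).
  by apply: cvgMl; apply: cvg_expr; rewrite ger0_norm // ltW.
rewrite mul0r => /cvgr0Pnorm_lt/(_ _ e0)[n _ /(_ n (leqnn n))] nL.
apply: ltW; apply: le_lt_trans nL; apply: le_trans (ler_norm _).
apply: le_trans (dist_set_triangle (f x) (G n x) phi0) _.
rewrite distrC mulrDr addrC; apply: lerD; last exact: fG'.
by apply: ltW; case: (goodG n).
Qed.

(** A point [q] of [phi(x)] within [1] of [y] has norm less than [|y| + 1]. An
    average of such numbers is at least the smallest of them, and so exceeds
    [d(0, phi(x))]. *)
Lemma continuous_norm_majorant (R : realType) (tau : Type) (Y : normedModType R)
    (X : topologicalType) (phi : X -> set Y) :
  infinite_set [set: tau] -> weight_le Y tau -> PF_normal tau X -> lsc phi ->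
  (forall x, phi x !=set0) -> (forall x, compact (phi x)) ->
  exists r : X -> R, [/\ continuous r, forall x, 1 <= r x &
    forall x, dist_set 0 (phi x) < r x].
Proof.
move=> inf wY PF lphi phi0 phiK.
have [|r [cr hr]] := @approximate_hull_selection R tau Y R^o X phi
  (fun y => `|y| + 1) 1 inf wY PF lphi phi0 _ ltr01.
  by move=> x; exists (phi x).
have rP x : 1 <= r x /\ dist_set 0 (phi x) < r x.
  apply: (convex_hull_sub (C := [set t : R^o | 1 <= t /\ dist_set 0 (phi x) < t])
    _ _ (hr x)).
    apply/convex_setP => s t a b s0 t0 st [a1 da] [b1 db].
    have min_le : Num.min a b <= s *: a + t *: b.
      have -> : Num.min a b = s * Num.min a b + t * Num.min a b.
        by rewrite -mulrDl st mul1r.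
      by apply: lerD; apply: ler_wpM2l => //; rewrite ge_min lexx ?orbT.
    split; first by apply: le_trans min_le; rewrite le_min a1.
    by apply: lt_le_trans min_le; rewrite lt_min da.
  move=> _ [y [q phiq yq] <-]; split; first by rewrite lerDr.
  apply: le_lt_trans (dist_set_le 0 phiq) _.
  have := ler_distD y 0 q; rewrite !sub0r !normrN; lra.
by exists r; split=> // x; case: (rP x).
Qed.

(** * The selection theorem *)

Theorem corollary3p3 (R : realType) :
  (forall (tau : Type) (Y : completeNormedModType R) (alpha : R),
     infinite_set [set: tau] -> weight_le Y tau -> 0 <= alpha < 1 ->
     forall (X : topologicalType) (phi : X -> set Y),
       PF_normal tau X -> lsc phi ->
       (forall x, compact_paraconvex alpha (phi x)) ->
       exists f : X -> Y, continuous f /\ (forall x, phi x (f x)))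
  /\
  (forall alpha : R, 0 <= alpha < 1 ->
     exists delta : R, 0 < delta /\
       forall (tau : Type) (Y : completeNormedModType R)
              (X : topologicalType) (phi : X -> set Y) (g : X -> Y) (r : R),
         infinite_set [set: tau] -> weight_le Y tau ->
         PF_normal tau X -> lsc phi ->
         (forall x, compact_paraconvex alpha (phi x)) ->
         0 < r -> continuous g -> r_selection r phi g ->
         exists f : X -> Y,
           [/\ continuous f, forall x, phi x (f x)
             & forall x, `|g x - f x| < delta * r]).
Proof.
split=> [tau Y alpha inf wY a01 X phi PF lphi phiP|alpha a01].
  have [||r [cr r1 phir]] := continuous_norm_majorant inf wY PF lphi.
  - by move=> x; case: (phiP x).
  - by move=> x; case: (phiP x).
  have [|f [cf phif _]] := paraconvex_selection_near (g := fun=> 0) inf wY PF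
    lphi a01 phiP _ cr ltr01 r1 phir; first exact: cst_continuous.
  by exists f.
have a1 : 0 < 4 / (1 - alpha).
  by rewrite divr_gt0 // subr_gt0; case/andP: a01.
exists (4 / (1 - alpha) + 1); split; first by rewrite addr_gt0.
move=> tau Y X phi g r inf wY PF lphi phiP r0 cg gr.
have [||f [cf phif gf]] := paraconvex_selection_near (r := fun=> r) inf wY PF
  lphi a01 phiP cg _ r0 _ gr; [exact: cst_continuous|by []|].
exists f; split=> // x; apply: le_lt_trans (gf x) _.
by rewrite ltr_pM2r // ltrDl.
Qed.
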